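(* Let $\mathcal P=\{P_\theta:\theta\in\Theta\}$, $\Theta\subset\mathbb R^k$ open, be a parametric model on $(\mathcal X,\mathcal A)$, let $X_1,X_2,\dots$ be i.i.d. with distribution in $\mathcal P$, and fix $\theta_0\in\Theta$. Let $\kappa:\Theta\to\mathbb R^m$ be continuously differentiable in a neighborhood of $\theta_0$, with derivative matrix $\kappa'(\theta)\in\mathbb R^{m\times k}$. Let $\psi_\theta\in\Psi_k$ and $\psi_\kappa\in\Psi_m$, let $\hat\theta_n=t_n(X_1,\dots,X_n)$ be an estimator of $\theta$ and let $\hat\kappa_{\theta,n}=k_n(X_1,\dots,X_n;\theta)$, $\theta\in\Theta$, be $\mathbb R^m$-valued statistics indexed by $\theta$. Suppose there is a function $c:\Theta\to\mathbb R^{m\times k}$, continuous at $\theta_0$, such that for all sequences $\{\theta_n\}\subset\Theta$ with $\{\sqrt n(\theta_n-\theta_0)\}$ bounded: (a) $\sqrt n\,\bigl|\hat\theta_n-\theta_n-\frac1n\sum_{i=1}^n\psi_\theta(X_i;\theta_n)\bigr|\to0$ in $P_{\theta_0}$-probability; (b) $\sqrt n\,\bigl|\hat\kappa_{\theta_n,n}-\kappa(\theta_n)-\frac1n\sum_{i=1}^n\psi_\kappa(X_i;\theta_n)\bigr|\to0$ in $P_{\theta_0}$-probability; (c) $\bigl|\frac1{\sqrt n}\sum_{i=1}^n\psi_\kappa(X_i;\theta_n)-\frac1{\sqrt n}\sum_{i=1}^n\psi_\kappa(X_i;\theta_0)-c(\theta_0)\sqrt n(\theta_n-\theta_0)\bigr|\to0$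 in $P_{\theta_0}$-probability. Suppose moreover that for every $\delta>0$, $\varepsilon>0$ and $M>0$ there exist $\zeta>0$ and $n_0\in\mathbb N$ such that for all $n\ge n_0$ $$P_{\theta_0}\Bigl(\sup_{\sqrt n|\theta-\theta_0|\le M,\ \sqrt n|\theta-\tilde\theta|\le\zeta}\sqrt n\,|\hat\kappa_{\theta,n}-\hat\kappa_{\tilde\theta,n}|\ge\varepsilon\Bigr)\le\delta,$$ the supremum being over $\theta,\tilde\theta\in\Theta$. Then the substitution estimator $\hat\kappa_{n,1}=\hat\kappa_{\hat\theta_n,n}=k_n(X_1,\dots,X_n;\hat\theta_n)$ is a locally asymptotically linear estimator of $\kappa$ at $\theta_0$ with influence function $$\tilde\psi(x;\theta)=\psi_\kappa(x;\theta)+(\kappa'(\theta)+c(\theta))\psi_\theta(x;\theta),$$ that is, for every sequence $\{\theta_n\}\subset\Theta$ with $\{\sqrt n(\theta_n-\theta_0)\}$ bounded, $$\sqrt n\,\Bigl|\hat\kappa_{\hat\theta_n,n}-\kappa(\theta_n)-\frac1n\sum_{i=1}^n\tilde\psi(X_i;\theta_n)\Bigr|\to0\quad\text{in }P_{\theta_0}\text{-probability}.$$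
   Context: For $m\in\mathbb N$, $\Psi_m$ is the set of all measurable $\psi:\mathcal X\times\Theta\to\mathbb R^m$ such that $\int\psi(x;\theta)\,dP_\theta(x)=0$ and $\int|\psi(x;\theta)|^2\,dP_\theta(x)<\infty$ for all $\theta\in\Theta$; $|\cdot|$ is a Euclidean norm. ''In $P_{\theta_0}$-probability'' means convergence in probability when $X_1,X_2,\dots$ are i.i.d. with distribution $P_{\theta_0}$. The maps $t_n:\mathcal X^n\to\mathbb R^k$ and $k_n:\mathcal X^n\times\Theta\to\mathbb R^m$ are measurable; if an estimator of $\theta$ takes a value outside $\Theta$, the substituted statistic may be defined arbitrarily (measurably). Probabilities of possibly nonmeasurable suprema are outer probabilities. *)

(* Defs.v *)
From HB Require Import structures.
From mathcomp Require Import all_boot all_order all_algebra finmap.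
From mathcomp Require Import all_classical all_reals all_analysis.

Set Implicit Arguments.
Unset Strict Implicit.
Unset Printing Implicit Defensive.

Import Order.TTheory GRing.Theory Num.Theory.
Import numFieldNormedType.Exports.

Local Open Scope classical_set_scope.
Local Open Scope ring_scope.

(* Points of R^k are row vectors, which is what [jacobian] expects. *)
Notation borel_rV R k := (g_sigma_algebraType (@open 'rV[R]_k)).

(* The library norm `|v| on 'rV[R]_k is the sup norm. *)
Definition enorm (R : realType) (k : nat) (v : 'rV[R]_k) : R :=
  Num.sqrt (\sum_(i < k) v 0 i ^+ 2).

(* The product A v, with v and the result stored as rows. *)
Definition mxact (R : realType) (m k : nat) (A : 'M[R]_(m, k)) (v : 'rV[R]_k)
  : 'rV[R]_m := (A *m v^T)^T.

(* [jacobian f x] acts on rows from the right, so it is the transpose of the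
   usual m x k derivative matrix. *)
Definition derivmx (R : realType) (k m : nat) (f : 'rV[R]_k -> 'rV[R]_m)
  (x : 'rV[R]_k) : 'M[R]_(m, k) := (jacobian f x)^T.

(* Only the values of [f] on the open set of parameters near [x] matter here:
   differentiability and continuity at a point are local. *)
Definition C1_near (R : realType) (k m : nat) (f : 'rV[R]_k -> 'rV[R]_m)
  (x : 'rV[R]_k) : Prop :=
  \forall y \near x, differentiable f y /\ {for y, continuous (derivmx f)}.

Definition measurable_on (R : realType) (d : measure_display)
  (T : measurableType d) (k m : nat) (Theta : set 'rV[R]_k)
  (f : T -> 'rV[R]_k -> 'rV[R]_m) : Prop :=
  measurable_fun ([set: T] `*` (Theta : set (borel_rV R k)))
    (fun p : T * borel_rV R k => f p.1 p.2 : borel_rV R m).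

Definition Psi (R : realType) (d : measure_display) (X : measurableType d)
  (k : nat) (Theta : set 'rV[R]_k) (P : 'rV[R]_k -> probability X R) (m : nat)
  : set (X -> 'rV[R]_k -> 'rV[R]_m) :=
  [set psi | measurable_on Theta psi /\
    forall theta, Theta theta ->
      (forall i : 'I_m, \int[P theta]_x (psi x theta 0 i)%:E = 0)%E /\
      (\int[P theta]_x (enorm (psi x theta) ^+ 2)%:E < +oo)%E].

Section Sampling.
Context (R : realType) (dO : measure_display) (Omega : measurableType dO)
  (Pr : probability Omega R) (d : measure_display) (X : measurableType d).

Definition independent (Xs : nat -> {RV Pr >-> X}) : Prop :=
  forall (J : {fset nat}) (A : nat -> set X), (forall i, measurable (A i)) ->
    Pr (\bigcap_(i in [set` J]) (Xs i @^-1` A i)) =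
    (\prod_(i <- J) Pr (Xs i @^-1` A i))%E.

Definition iid (Xs : nat -> {RV Pr >-> X}) (Q : probability X R) : Prop :=
  independent Xs /\
  forall i (A : set X), measurable A -> distribution Pr (Xs i) A = Q A.

Definition sample (Xs : nat -> {RV Pr >-> X}) (n : nat) (w : Omega)
  : n.-tuple X := [tuple Xs i w | i < n].

Definition sum_sample (Xs : nat -> {RV Pr >-> X}) (k m : nat)
  (psi : X -> 'rV[R]_k -> 'rV[R]_m) (n : nat) (theta : 'rV[R]_k) (w : Omega)
  : 'rV[R]_m := \sum_(i < n) psi (Xs i w) theta.

Definition cvg0_in_probability (Z : nat -> Omega -> R) : Prop :=
  forall e : R, 0 < e -> Pr [set w | e < `|Z n w|] @[n --> \oo] --> 0%E.

Definition outer_probability (A : set Omega) : \bar R :=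
  ereal_inf [set Pr B | B in [set B | measurable B /\ A `<=` B]].

End Sampling.

Definition sqrtn (R : realType) (n : nat) : R := Num.sqrt n%:R.
Arguments sqrtn {R} n.

Definition local_sequence (R : realType) (k : nat) (Theta : set 'rV[R]_k)
  (theta0 : 'rV[R]_k) (theta : nat -> 'rV[R]_k) : Prop :=
  (forall n, Theta (theta n)) /\
  exists M : R, forall n, enorm (sqrtn n *: (theta n - theta0)) <= M.

Definition loc_asymp_linear (R : realType) (dO : measure_display)
  (Omega : measurableType dO) (Pr : probability Omega R)
  (d : measure_display) (X : measurableType d) (Xs : nat -> {RV Pr >-> X})
  (k m : nat) (Theta : set 'rV[R]_k) (theta0 : 'rV[R]_k)
  (T : forall n, n.-tuple X -> 'rV[R]_m) (kappa : 'rV[R]_k -> 'rV[R]_m)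
  (psi : X -> 'rV[R]_k -> 'rV[R]_m) : Prop :=
  forall theta, local_sequence Theta theta0 theta ->
    cvg0_in_probability Pr (fun n w =>
      sqrtn n * enorm (T n (sample Xs n w) - kappa (theta n)
                       - n%:R^-1 *: sum_sample Xs psi n (theta n) w)).

(* Main.v *)
Require Import Defs.
From HB Require Import structures.
From mathcomp Require Import all_boot all_order all_algebra finmap.
From mathcomp Require Import all_classical all_reals all_analysis.
From mathcomp Require Import measurable_realfun ring lra.

Set Implicit Arguments.
Unset Strict Implicit.
Unset Printing Implicit Defensive.

Import Order.TTheory GRing.Theory Num.Theory.
Import numFieldNormedType.Exports.

Local Open Scope classical_set_scope.
Local Open Scope ring_scope.

(** Write s = sqrt n, S_n(theta) for the sum of psi_kappa(X_i; theta), A for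
    kappa'(theta0) + c(theta0), and T_n for the estimator of theta.  Along every
    local sequence, (b), (c) and the differentiability of kappa give
      s (k_n(theta_n) - kappa(theta0))
        = S_n(theta0) / s + A s (theta_n - theta0) + o_P(1).
    By (a) at theta0 and Chebyshev's inequality s (T_n - theta0) is tight, so up
    to small probability T_n stays within zeta / s of finitely many
    deterministic local sequences; the equicontinuity assumption then allows
    T_n to replace theta_n in the expansion.  Recentering at theta_n by (a),
    (c) and the continuity of kappa' + c at theta0 yields the theorem.  Only
    tightness at theta0 is required: s (T_n - theta_n) inherits it, and (a)
    passes it on to the sums of psi_theta at theta_n. *)

(** * Second moments of i.i.d. sums *)

(** The product is dominated by the integrable sum of squares, since |f g| <= f^2 + g^2. *)
Lemma integrable_sqr_mul (R : realType) (d : measure_display)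
    (T : measurableType d) (mu : {measure set T -> \bar R}) (f g : T -> R) :
  measurable_fun setT f -> measurable_fun setT g ->
  mu.-integrable setT (fun x => (f x ^+ 2)%:E) ->
  mu.-integrable setT (fun x => (g x ^+ 2)%:E) ->
  mu.-integrable setT (fun x => (f x * g x)%:E).
Proof.
move=> mf mg If Ig.
apply: (le_integrable _ _ _ (integrableD _ If Ig)) => //.
  by apply/measurable_EFinP; exact: measurable_funM.
move=> x _; rewrite /= lee_fin normrM.
rewrite [leRHS]ger0_norm ?addr_ge0 ?sqr_ge0//.
rewrite -[f x ^+ 2]real_normK ?num_real// -[g x ^+ 2]real_normK ?num_real//.
have := normr_ge0 (f x); have := normr_ge0 (g x); nra.
Qed.

Section Moments.
Context (R : realType) (dO : measure_display) (Omega : measurableType dO)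
  (Pr : probability Omega R) (d : measure_display) (X : measurableType d)
  (Q : probability X R).

(** A measure with the product values on rectangles is the product measure. On B x C, independence
    is applied to the index set {i, j}, with [D] choosing B at i and C elsewhere; this choice is
    consistent because i and j differ. *)
Lemma iid_pair_prod (Xs : nat -> {RV Pr >-> X}) (i j : nat) :
  iid Xs Q -> i != j -> forall A : set (X * X), measurable A ->
  (Q \x Q)%E A = pushforward Pr (fun w => (Xs i w, Xs j w)) A.
Proof.
move=> [ind dist] ij A mA.
have mp : measurable_fun setT (fun w => (Xs i w, Xs j w)).
  by apply: measurable_fun_pair.
pose f : {mfun Omega >-> (X * X)%type} :=
  HB.pack (fun w => (Xs i w, Xs j w)) (isMeasurableFun.Build _ _ _ _ _ mp).
apply: (product_measure_unique (m' := distribution Pr f)) => // B C mB mC.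
rewrite /distribution /pushforward /=.
pose D l := if l == i then B else C.
have := ind [fset i; j]%fset D.
have -> : \bigcap_(l in [set` [fset i; j]%fset]) (Xs l @^-1` D l) =
  (fun w => (Xs i w, Xs j w)) @^-1` (B `*` C).
  apply/seteqP; split => w /=.
    move=> H; split.
      by have := H i; rewrite /= !inE eqxx /D eqxx; apply.
    by have := H j; rewrite /= !inE eqxx orbT /D eq_sym (negbTE ij); apply.
  move=> [Bi Cj] l /=; rewrite !inE => /orP[] /eqP ->; rewrite /D ?eqxx//.
  by rewrite eq_sym (negbTE ij).
move=> H; transitivity (\prod_(l <- [fset i; j]%fset) Pr (Xs l @^-1` D l))%E.
  by apply: H => l; rewrite /D; case: ifP.
rewrite big_fsetU1 ?inE//= big_seq_fset1 /D eqxx eq_sym (negbTE ij).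
by congr *%E; exact: dist.
Qed.

(** The integral moves to [Q \x Q] along the joint law of the pair; by Fubini the inner integral is
    f(x) times the mean of f, hence zero. *)
Lemma iid_uncorrelated (Xs : nat -> {RV Pr >-> X}) (i j : nat) (f : X -> R) :
  iid Xs Q -> i != j -> Q.-integrable setT (EFin \o f) ->
  (\int[Q]_x (f x)%:E = 0)%E ->
  Pr.-integrable setT (fun w => (f (Xs i w) * f (Xs j w))%:E) ->
  (\int[Pr]_w (f (Xs i w) * f (Xs j w))%:E = 0)%E.
Proof.
move=> Hiid ij If f0 intf.
have mf : measurable_fun setT f.
  by apply/measurable_EFinP; exact: measurable_int If.
have mp : measurable_fun setT (fun w => (Xs i w, Xs j w)).
  by apply: measurable_fun_pair.
pose g (p : X * X) := (f p.1 * f p.2)%:E.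
have mg : measurable_fun setT g.
  apply/measurable_EFinP; apply: measurable_funM; exact: measurableT_comp.
have E (h : X * X -> \bar R) :
    (\int[pushforward Pr (fun w => (Xs i w, Xs j w))]_z h z
     = \int[(Q \x Q)%E]_z h z)%E.
  by apply: eq_measure_integral => A mA _; rewrite /= (iid_pair_prod Hiid ij).
have intg : (Q \x Q)%E.-integrable setT g.
  have /integrableP[_ H] := integrable_pushforward mp mg intf measurableT.
  by apply/integrableP; split => //; rewrite -E.
transitivity (\int[Pr]_(w in (fun w => (Xs i w, Xs j w)) @^-1` setT)
  (g \o (fun w => (Xs i w, Xs j w))) w)%E; first by rewrite preimage_setT.
rewrite -(integral_pushforward mp mg)// E -integral12_prod_meas1//.
apply: integral0_eq => x _; rewrite /fubini_F /g /=.
under eq_integral do rewrite EFinM.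
by rewrite integralZl// f0 mule0.
Qed.

(** The square expands into a double sum: off-diagonal terms integrate to zero, and each of the n
    diagonal terms contributes the second moment of f. *)
Lemma iid_sum_sqr (Xs : nat -> {RV Pr >-> X}) (f : X -> R) (n : nat) :
  iid Xs Q -> Q.-integrable setT (EFin \o f) ->
  Q.-integrable setT (fun x => (f x ^+ 2)%:E) ->
  (\int[Q]_x (f x)%:E = 0)%E ->
  Pr.-integrable setT (fun w => ((\sum_(i < n) f (Xs i w)) ^+ 2)%:E) /\
  (\int[Pr]_w ((\sum_(i < n) f (Xs i w)) ^+ 2)%:E
   = n%:R%:E * \int[Q]_x (f x ^+ 2)%:E)%E.
Proof.
move=> Hiid If If2 f0.
have mf : measurable_fun setT f.
  by apply/measurable_EFinP; exact: measurable_int If.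
have mfX i : measurable_fun setT (fun w => f (Xs i w)).
  exact: measurableT_comp.
have mf2 : measurable_fun setT (fun x => (f x ^+ 2)%:E).
  by apply/measurable_EFinP; exact: measurable_funX.
have E i : (\int[Pr]_w (f (Xs i w) ^+ 2)%:E = \int[Q]_x (f x ^+ 2)%:E)%E.
  rewrite -[LHS](@ge0_integral_distribution _ _ _ _ _ _ (Xs i)
    (fun x => (f x ^+ 2)%:E))//.
    by apply: eq_measure_integral => A mA _; rewrite /= Hiid.2.
  by move=> y; rewrite lee_fin sqr_ge0.
have IX i : Pr.-integrable setT (fun w => (f (Xs i w) ^+ 2)%:E).
  apply/integrableP; split.
    by apply/measurable_EFinP; exact: measurable_funX.
  under eq_integral do rewrite gee0_abs ?lee_fin ?sqr_ge0//.
  rewrite E; case/integrableP: If2 => _.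
  by under eq_integral do rewrite gee0_abs ?lee_fin ?sqr_ge0//.
have IXX i j : Pr.-integrable setT (fun w => (f (Xs i w) * f (Xs j w))%:E).
  exact: integrable_sqr_mul.
have -> : (fun w => ((\sum_(i < n) f (Xs i w)) ^+ 2)%:E) =
   (fun w => \sum_(i < n) \sum_(j < n) (f (Xs i w) * f (Xs j w))%:E)%E.
  apply/funext => w; rewrite expr2 mulr_suml -sumEFin; apply: eq_bigr => i _.
  by rewrite mulr_sumr -sumEFin.
have I1 i : Pr.-integrable setT
    (fun w => \sum_(j < n) (f (Xs i w) * f (Xs j w))%:E)%E.
  by apply: integrable_sum => // j _; exact: IXX.
split; first by apply: integrable_sum => // i _; exact: I1.
rewrite integral_sum//.
transitivity (\sum_(i < n) \int[Q]_x (f x ^+ 2)%:E)%E; last first.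
  by rewrite sumr_const card_ord mule_natl.
apply: eq_bigr => i _.
rewrite integral_sum//.
rewrite (bigD1 i)//= big1 ?adde0 => [|j ji].
  by under eq_integral do rewrite -expr2.
by apply: (iid_uncorrelated Hiid _ If f0 (IXX i j)); rewrite eq_sym.
Qed.

(** Chebyshev's inequality: the second moment of the sum grows like n, so after division by sqrt n
    one bound serves all n. *)
Lemma iid_sum_tight (Xs : nat -> {RV Pr >-> X}) (f : X -> R) (del : R) :
  iid Xs Q -> Q.-integrable setT (EFin \o f) ->
  Q.-integrable setT (fun x => (f x ^+ 2)%:E) ->
  (\int[Q]_x (f x)%:E = 0)%E -> 0 < del ->
  exists M : R, forall n, exists B : set Omega,
    [/\ measurable B, (Pr B <= del%:E)%E &
       ~` B `<=` [set w | `|(sqrtn n)^-1 * \sum_(i < n) f (Xs i w)| <= M]].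
Proof.
move=> Hiid If If2 f0 del0.
set s2 := (\int[Q]_x (f x ^+ 2)%:E)%E.
have s2fin : s2 \is a fin_num by exact: integrable_fin_num.
have s20 : 0 <= fine s2.
  by apply: fine_ge0; apply: integral_ge0 => x _; rewrite lee_fin sqr_ge0.
(* The exceptional event has probability at most s2 / M2 <= del; the added 1 keeps M2 positive when
   the second moment is zero. *)
pose M2 := (fine s2 + 1) / del.
have M20 : 0 < M2 by rewrite divr_gt0// ltr_wpDl.
exists (Num.sqrt M2) => n.
case: n => [|n].
  exists set0; split => //; first by rewrite measure0 lee_fin ltW.
  by move=> w _ /=; rewrite big_ord0 mulr0 normr0 sqrtr_ge0.
have [IS ES] := iid_sum_sqr n.+1 Hiid If If2 f0.
pose g w := ((\sum_(i < n.+1) f (Xs i w)) ^+ 2)%:E.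
pose a : R := n.+1%:R * M2.
have a0 : 0 < a by rewrite mulr_gt0.
have mg : measurable_fun setT g by exact: measurable_int IS.
exists (setT `&` [set w | a%:E <= `|g w|]%E); split.
- by apply: emeasurable_fun_c_infty => //; exact: measurableT_comp.
- have := @le_integral_comp_abse _ _ _ Pr _ measurableT g a id
    (@measurable_id _ _ _) (fun _ => id) (fun _ _ _ _ => id) mg a0.
  rewrite /=; under eq_integral do rewrite ger0_norm ?sqr_ge0//.
  rewrite ES -/s2 -(fineK s2fin) -EFinM => H.
  rewrite -(@lee_pmul2l _ a%:E)// (le_trans H)//.
  rewrite -EFinM lee_fin /a -mulrA ler_pM2l//.
  by rewrite /M2 divfK ?gt_eqF// lerDl.
- move=> w nB; have /negP : ~ (a%:E <= `|g w|)%E by move=> ?; exact: nB.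
  rewrite -ltNge /= lte_fin ger0_norm ?sqr_ge0// /a => H.
  rewrite -ler_sqr ?nnegrE ?sqrtr_ge0// real_normK ?num_real// exprMn exprVn.
  rewrite !sqr_sqrtr ?(ltW M20)//.
  by rewrite mulrC ler_pdivrMr// mulrC ltW.
Qed.

End Moments.

(** * Vectors and matrices *)

Section Norms.
Context (R : realType).

Lemma mxnorm_ge_coord (m n : nat) (A : 'M[R]_(m, n)) i j : `|A i j| <= `|A|.
Proof.
rewrite [leRHS]mx_normrE.
exact: (le_bigmax _ (fun ij => `|A ij.1 ij.2|) (i, j)).
Qed.

Lemma mxnorm_le (m n : nat) (A : 'M[R]_(m, n)) (x : R) :
  0 <= x -> (forall i j, `|A i j| <= x) -> `|A| <= x.
Proof. by move=> x0 H; rewrite [leLHS]mx_normrE; apply: bigmax_le. Qed.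

Lemma enorm_ge0 (k : nat) (v : 'rV[R]_k) : 0 <= enorm v.
Proof. exact: sqrtr_ge0. Qed.

Lemma enorm0 (k : nat) : enorm (0 : 'rV[R]_k) = 0.
Proof.
by rewrite /enorm big1 ?sqrtr0// => i _; rewrite mxE expr0n.
Qed.

Lemma norm_le_enorm (k : nat) (v : 'rV[R]_k) : `|v| <= enorm v.
Proof.
apply: mxnorm_le; first exact: enorm_ge0.
move=> i j; rewrite ord1 -sqrtr_sqr ler_wsqrtr// (bigD1 j)//= lerDl.
by apply: sumr_ge0 => ? _; rewrite sqr_ge0.
Qed.

(** Any constant depending on k alone will do; the factor k, cruder than sqrt k, comes from k <= k^2
    under the root. *)
Lemma enorm_le_norm (k : nat) (v : 'rV[R]_k) : enorm v <= k%:R * `|v|.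
Proof.
rewrite -(@ger0_norm _ (k%:R * `|v|)) ?mulr_ge0// -sqrtr_sqr ler_wsqrtr//.
apply: (@le_trans _ _ (\sum_(i < k) `|v| ^+ 2)).
  apply: ler_sum => i _; rewrite -real_normK ?num_real//.
  by rewrite ler_sqr ?nnegrE// mxnorm_ge_coord.
rewrite sumr_const card_ord -[leLHS]mulr_natl exprMn ler_wpM2r ?sqr_ge0//.
by rewrite -natrX ler_nat; case: k v => // k _; rewrite expnS expn1 leq_pmulr.
Qed.

Lemma enormZ (k : nat) (a : R) (v : 'rV[R]_k) :
  0 <= a -> enorm (a *: v) = a * enorm v.
Proof.
move=> a0; rewrite /enorm -{2}(ger0_norm a0) -sqrtr_sqr -sqrtrM ?sqr_ge0//.
by rewrite mulr_sumr; congr Num.sqrt; apply: eq_bigr => i _; rewrite mxE exprMn.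
Qed.

Lemma mxactE (m k : nat) (A : 'M[R]_(m, k)) (v : 'rV[R]_k) i :
  mxact A v 0 i = \sum_(j < k) A i j * v 0 j.
Proof. by rewrite !mxE; apply: eq_bigr => j _; rewrite mxE. Qed.

Lemma mxactB (m k : nat) (A : 'M[R]_(m, k)) : {morph mxact A : u v / u - v}.
Proof. by move=> u v; rewrite /mxact !linearB. Qed.

Lemma mxactZ (m k : nat) (A : 'M[R]_(m, k)) (a : R) v :
  mxact A (a *: v) = a *: mxact A v.
Proof. by rewrite /mxact !linearZ. Qed.

Lemma mxactDl (m k : nat) (A B : 'M[R]_(m, k)) v :
  mxact (A + B) v = mxact A v + mxact B v.
Proof. by rewrite /mxact mulmxDl linearD. Qed.

Lemma mxactBl (m k : nat) (A B : 'M[R]_(m, k)) v :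
  mxact (A - B) v = mxact A v - mxact B v.
Proof. by rewrite /mxact mulmxBl linearB. Qed.

Lemma mxact_sum (m k : nat) (A : 'M[R]_(m, k)) (I : Type) (r : seq I)
    (F : I -> 'rV[R]_k) :
  mxact A (\sum_(i <- r) F i) = \sum_(i <- r) mxact A (F i).
Proof. by rewrite /mxact !linear_sum. Qed.

Lemma mxact_norm (m k : nat) (A : 'M[R]_(m, k)) (v : 'rV[R]_k) :
  `|mxact A v| <= k%:R * `|A| * `|v|.
Proof.
apply: mxnorm_le; first by rewrite !mulr_ge0.
move=> i j; rewrite ord1 mxactE (le_trans (ler_norm_sum _ _ _))//.
apply: (@le_trans _ _ (\sum_(l < k) `|A| * `|v|)).
  by apply: ler_sum => l _; rewrite normrM ler_pM// mxnorm_ge_coord.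
by rewrite sumr_const card_ord -[leLHS]mulr_natl mulrA.
Qed.

(* The points with coordinates in [- M + z * {0, .., N}], with [N = floor (2 M / z)]. *)
Lemma finite_net (k : nat) (M z : R) : 0 < z ->
  exists L : seq 'rV[R]_k, forall h, `|h| <= M ->
    exists2 g, g \in L & `|h - g| <= z.
Proof.
move=> z0; pose N := Num.truncn (2 * M / z).
pose pt (f : {ffun 'I_k -> 'I_N.+1}) : 'rV[R]_k := \row_i (- M + z * (f i)%:R).
exists [seq pt f | f : {ffun 'I_k -> 'I_N.+1}] => h hM.
(* Each coordinate of h is rounded down to the grid, with an error below z; the bound on h keeps the
   index at most N, so [inord] does not truncate it. *)
pose f := [ffun i : 'I_k => inord (Num.truncn ((h 0 i + M) / z)) : 'I_N.+1].
exists (pt f); first by apply: map_f; rewrite mem_enum.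
apply: mxnorm_le; first exact: ltW.
move=> i j; rewrite ord1 !mxE ffunE.
have /ler_normlP[h1 h2] : `|h 0 j| <= M.
  exact: le_trans (mxnorm_ge_coord _ _ _) hM.
have x0 : 0 <= (h 0 j + M) / z by rewrite divr_ge0 ?(ltW z0)//; lra.
rewrite inordK; last first.
  rewrite ltnS /N; apply: le_truncn; rewrite ler_pM2r ?invr_gt0//; lra.
have /andP[t1 t2] := truncn_itv x0.
rewrite ler_pdivlMr// in t1; rewrite ltr_pdivrMr// -natr1 in t2.
by apply/ler_normlP; split; nra.
Qed.

End Norms.

(** * Measurability, and stochastic order symbols *)

Section Measurability.
Context (R : realType).

Lemma measurable_coord (k : nat) (i : 'I_k) :
  measurable_fun setT (fun v : borel_rV R k => (v : 'rV[R]_k) 0 i).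
Proof.
apply: (measurability _ (RGenOInfty.measurableE R)) => _ [_ [x ->]] <-.
rewrite setTI; apply: sub_sigma_algebra.
apply: (@open_comp 'rV[R]_k R (fun v => v 0 i)); last exact: rray_open.
by move=> v _; exact: coord_continuous.
Qed.

(** The function is measurable only on the strip over Theta, so the section x -> (x, theta) is
    composed within that strip, which is measurable because Theta is open. *)
Lemma measurable_section (d : measure_display) (T : measurableType d)
    (k m : nat) (Theta : set 'rV[R]_k) (f : T -> 'rV[R]_k -> 'rV[R]_m)
    (theta : 'rV[R]_k) (i : 'I_m) :
  open Theta -> measurable_on Theta f -> Theta theta ->
  measurable_fun setT (fun x => f x theta 0 i).
Proof.
move=> oT mf Tt.
apply: (measurableT_comp (measurable_coord i)
  (g := fun x : T => f x theta : borel_rV R m)).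
apply: (measurable_comp (F := [set: T] `*` (Theta : set (borel_rV R k)))
  (f := fun p : T * borel_rV R k => f p.1 p.2 : borel_rV R m)
  (g := fun x : T => (x, theta : borel_rV R k))).
- by apply: measurableX => //; exact: sub_sigma_algebra.
- by move=> _ [x _ <-].
- exact: mf.
- exact: pair2_measurable.
Qed.

Lemma measurable_sample (dO : measure_display) (Omega : measurableType dO)
    (Pr : probability Omega R) (d : measure_display) (X : measurableType d)
    (Xs : nat -> {RV Pr >-> X}) (n : nat) :
  measurable_fun setT (sample Xs n).
Proof.
apply/measurable_fun_tnthP => i.
rewrite (_ : _ \o _ = Xs i)//; apply/funext => w /=.
by rewrite tnth_mktuple.
Qed.

(** Working by coordinates reduces closure under vector operations to real-valued functions, and it
    suffices for [enorm] to be measurable. *)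
Definition coord_measurable (d : measure_display) (T : measurableType d)
    (m : nat) (f : T -> 'rV[R]_m) : Prop :=
  forall i, measurable_fun setT (fun x => f x 0 i).

Section Closure.
Context (d : measure_display) (T : measurableType d) (m : nat).
Implicit Types f g : T -> 'rV[R]_m.

Lemma coord_measurable_cst (v : 'rV[R]_m) : coord_measurable (fun _ : T => v).
Proof. by move=> i; exact: measurable_cst. Qed.

Lemma coord_measurableD f g : coord_measurable f -> coord_measurable g ->
  coord_measurable (fun x => f x + g x).
Proof.
move=> mf mg i; under eq_fun do rewrite mxE.
exact: measurable_funD.
Qed.

Lemma coord_measurableZ a f : coord_measurable f ->
  coord_measurable (fun x => a *: f x).
Proof.
move=> mf i; under eq_fun do rewrite mxE.
exact: measurable_funM.
Qed.

Lemma coord_measurableB f g : coord_measurable f -> coord_measurable g ->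
  coord_measurable (fun x => f x - g x).
Proof.
move=> mf mg; apply: coord_measurableD => //.
by under eq_fun do rewrite -scaleN1r; exact: coord_measurableZ.
Qed.

Lemma coord_measurable_sum (n : nat) (F : 'I_n -> T -> 'rV[R]_m) :
  (forall j, coord_measurable (F j)) ->
  coord_measurable (fun x => \sum_(j < n) F j x).
Proof.
move=> mF i; under eq_fun do rewrite summxE.
by apply: measurable_sum => j; exact: mF.
Qed.

Lemma coord_measurable_mxact (p : nat) (A : 'M[R]_(p, m)) f :
  coord_measurable f -> coord_measurable (fun x => mxact A (f x)).
Proof.
move=> mf i; under eq_fun do rewrite mxactE.
by apply: measurable_sum => j; exact: measurable_funM.
Qed.

Lemma measurable_enorm f : coord_measurable f ->
  measurable_fun setT (fun x => enorm (f x)).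
Proof.
move=> mf; have ms : measurable_fun setT (@Num.sqrt R).
  by apply: continuous_measurable_fun; exact: sqrt_continuous.
apply: (measurableT_comp ms).
by apply: measurable_sum => j; exact: measurable_funX.
Qed.

End Closure.

Lemma coord_measurable_sum_sample (dO : measure_display)
    (Omega : measurableType dO) (Pr : probability Omega R)
    (d : measure_display) (X : measurableType d) (Xs : nat -> {RV Pr >-> X})
    (k m : nat) (psi : X -> 'rV[R]_k -> 'rV[R]_m) (n : nat) (theta : 'rV[R]_k) :
  coord_measurable (psi ^~ theta) ->
  coord_measurable (sum_sample Xs psi n theta).
Proof.
move=> mpsi; apply: coord_measurable_sum => j i.
exact: (measurableT_comp (mpsi i)).
Qed.

End Measurability.

Section HighProbability.
Context (R : realType) (dO : measure_display) (Omega : measurableType dO)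
  (Pr : probability Omega R).

(* The exceptional sets [B] are measurable, so that the events [A n]
   themselves may be nonmeasurable. *)
Definition whp (del : R) (A : nat -> set Omega) : Prop :=
  \forall n \near \oo, exists B, [/\ measurable B, (Pr B <= del%:E)%E &
    ~` B `<=` A n].

Lemma whpI del1 del2 A1 A2 : whp del1 A1 -> whp del2 A2 ->
  whp (del1 + del2) (fun n => A1 n `&` A2 n).
Proof.
apply: filterS2 => n [B1 [m1 P1 s1]] [B2 [m2 P2 s2]].
exists (B1 `|` B2); split.
- exact: measurableU.
- by rewrite (le_trans (measureU2 _ m1 m2))// EFinD leeD.
- by rewrite setCU; exact: setISS.
Qed.

Lemma whp_sub del A1 A2 : whp del A1 ->
  (\forall n \near \oo, A1 n `<=` A2 n) -> whp del A2.
Proof.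
apply: filterS2 => n [B [mB PB sB]] s; exists B; split => //.
exact: subset_trans s.
Qed.

Lemma whp_near del A : 0 <= del -> (\forall n \near \oo, forall w, A n w) ->
  whp del A.
Proof.
move=> del0; apply: filterS => n An; exists set0; split => //.
by rewrite measure0 lee_fin.
Qed.

(** Finite union bound: the head of the list receives half of [del], the tail the other half. *)
Lemma whp_seq (T : eqType) (L : seq T) (A : T -> nat -> set Omega) :
  (forall g, g \in L -> forall del, 0 < del -> whp del (A g)) ->
  forall del, 0 < del ->
    whp del (fun n => [set w | forall g, g \in L -> A g n w]).
Proof.
elim: L => [|g L IH] HL del del0.
  by apply: whp_near; rewrite ?ltW//; near=> n.
have d20 : 0 < del / 2 by rewrite divr_gt0.
have H1 := HL g (mem_head _ _) _ d20.
have H2 := IH (fun x xL => HL x (mem_behead (s := g :: L) xL)) _ d20.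
have := whpI H1 H2; rewrite -splitr => /whp_sub; apply.
near=> n => w [H1w H2w] x; rewrite inE => /orP[/eqP->//|]; exact: H2w.
Unshelve. all: by end_near. Qed.

(** By measurability of [Z n] the event e < |Z n| can itself serve as exceptional set; conversely
    every exceptional set contains it. *)
Lemma cvg0_whp (Z : nat -> Omega -> R) :
  (forall n, measurable_fun setT (Z n)) ->
  cvg0_in_probability Pr Z <->
  (forall e del, 0 < e -> 0 < del ->
    whp del (fun n => [set w | `|Z n w| <= e])).
Proof.
move=> mZ.
have mE e n : measurable [set w | e < `|Z n w|].
  have := @measurable_fun_ltr _ _ R setT (cst e) (fun w => `|Z n w|)
    (measurable_cst _) (measurableT_comp (@normr_measurable R setT) (mZ n))
    measurableT [set true].
  by rewrite setTI; apply.
split=> [Zcvg e del e0 del0|H e e0].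
  have /fine_cvgP[_ /cvgrPdist_le /(_ _ del0)] := Zcvg e e0.
  apply: filterS => n /=; rewrite sub0r normrN => Hn.
  exists [set w | e < `|Z n w|]; split; first exact: mE.
    rewrite -(@fineK _ (Pr _)) ?fin_num_measure// lee_fin.
    exact: le_trans (ler_norm _) Hn.
  by move=> w /= /negP; rewrite -leNgt.
apply/fine_cvgP; split; first by near=> n; exact: fin_num_measure.
apply/cvgrPdist_le => del del0; near=> n.
rewrite sub0r normrN /= ger0_norm ?fine_ge0//.
rewrite -lee_fin fineK ?fin_num_measure//.
have [B [mB PB sB]] : exists B, [/\ measurable B, (Pr B <= del%:E)%E &
    ~` B `<=` [set w | `|Z n w| <= e]] by near: n; exact: H.
apply: le_trans PB; apply: le_measure; rewrite ?inE//.
by move=> w /= ew; apply: contrapT => /sB /=; rewrite leNgt ew.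
Unshelve. all: by end_near. Qed.

(** The strict slack in [del'] yields a measurable cover of [A n] from the infimum without asking
    whether the infimum is attained. *)
Lemma outer_probability_whp (del : R) (A : nat -> set Omega) :
  (\forall n \near \oo, outer_probability Pr (A n) <= del%:E)%E ->
  forall del', del < del' -> whp del' (fun n => ~` A n).
Proof.
move=> H del' dd; apply: filterS H => n Hn.
have : (outer_probability Pr (A n) < del'%:E)%E.
  by rewrite (le_lt_trans Hn)// lte_fin.
case/ereal_inf_lt => _ [B [mB AB] <-] PB.
exists B; split => //; first exact: ltW.
exact: subsetC.
Qed.

(** The symbol o_P(1), in the sup norm; phrased through [whp], it makes sense without measurability
    of [Z]. Likewise [tight] is O_P(1). *)
Definition oP (m : nat) (Z : nat -> Omega -> 'rV[R]_m) : Prop :=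
  forall e del, 0 < e -> 0 < del -> whp del (fun n => [set w | `|Z n w| <= e]).

Definition tight (m : nat) (Z : nat -> Omega -> 'rV[R]_m) : Prop :=
  forall del, 0 < del ->
    exists M, whp del (fun n => [set w | `|Z n w| <= M]).

Lemma oPD m (Z1 Z2 : nat -> Omega -> 'rV[R]_m) :
  oP Z1 -> oP Z2 -> oP (fun n w => Z1 n w + Z2 n w).
Proof.
move=> o1 o2 e del e0 del0.
have e2 : 0 < e / 2 by rewrite divr_gt0.
have d2 : 0 < del / 2 by rewrite divr_gt0.
have := whpI (o1 _ _ e2 d2) (o2 _ _ e2 d2); rewrite -splitr => /whp_sub; apply.
near=> n => w [/= h1 h2]; rewrite (le_trans (ler_normD _ _))//.
by rewrite [leRHS]splitr lerD.
Unshelve. all: by end_near. Qed.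

Lemma oPN m (Z : nat -> Omega -> 'rV[R]_m) : oP Z -> oP (fun n w => - Z n w).
Proof.
move=> o e del e0 del0; apply: whp_sub (o e del e0 del0) _.
by near=> n => w /=; rewrite normrN.
Unshelve. all: by end_near. Qed.

Lemma oPB m (Z1 Z2 : nat -> Omega -> 'rV[R]_m) :
  oP Z1 -> oP Z2 -> oP (fun n w => Z1 n w - Z2 n w).
Proof. by move=> o1 o2; apply: oPD => //; exact: oPN. Qed.

Lemma eq_oP m (Z1 Z2 : nat -> Omega -> 'rV[R]_m) :
  (\forall n \near \oo, forall w, Z1 n w = Z2 n w) -> oP Z1 -> oP Z2.
Proof.
move=> E o e del e0 del0; apply: whp_sub (o e del e0 del0) _.
by near=> n => w /=; rewrite (near E n).
Unshelve. all: by end_near. Qed.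

Lemma oP_cvg0 m (z : nat -> 'rV[R]_m) :
  z @ \oo --> (0 : 'rV[R]_m) -> oP (fun n _ => z n).
Proof.
move=> /cvgr0Pnorm_le z0 e del e0 del0; apply: whp_near; first exact: ltW.
by near=> n => w /=; near: n; exact: z0.
Unshelve. all: by end_near. Qed.

Lemma oP_tight m (Z : nat -> Omega -> 'rV[R]_m) : oP Z -> tight Z.
Proof. by move=> o del del0; exists 1; exact: o. Qed.

Lemma tightD m (Z1 Z2 : nat -> Omega -> 'rV[R]_m) :
  tight Z1 -> tight Z2 -> tight (fun n w => Z1 n w + Z2 n w).
Proof.
move=> t1 t2 del del0.
have d2 : 0 < del / 2 by rewrite divr_gt0.
have [M1 H1] := t1 _ d2; have [M2 H2] := t2 _ d2; exists (M1 + M2).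
have := whpI H1 H2; rewrite -splitr => /whp_sub; apply.
near=> n => w [/= h1 h2]; rewrite (le_trans (ler_normD _ _))//.
by rewrite lerD.
Unshelve. all: by end_near. Qed.

Lemma tight_bounded m (z : nat -> 'rV[R]_m) (M : R) :
  (\forall n \near \oo, `|z n| <= M) -> tight (fun n _ => z n).
Proof.
move=> zM del del0; exists M; apply: whp_near; first exact: ltW.
by near=> n => w /=; near: n.
Unshelve. all: by end_near. Qed.

Lemma oP_mxact m k (A : nat -> 'M[R]_(m, k)) (Z : nat -> Omega -> 'rV[R]_k)
    (M : R) : (\forall n \near \oo, `|A n| <= M) -> oP Z ->
  oP (fun n w => mxact (A n) (Z n w)).
Proof.
move=> AM o e del e0 del0.
(* The absolute value and the added 1 make the divisor positive even when k = 0 or M is not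
   positive. *)
have c0 : 0 < k%:R * `|M| + 1 by rewrite ltr_wpDl// mulr_ge0.
have e'0 : 0 < e / (k%:R * `|M| + 1) by rewrite divr_gt0.
apply: whp_sub (o _ _ e'0 del0) _; near=> n => w /= h.
rewrite (le_trans (mxact_norm _ _))//.
rewrite ler_pdivlMr// mulrC in h; apply: le_trans h.
rewrite ler_wpM2r// (@le_trans _ _ (k%:R * `|M|)) ?lerDl//.
rewrite ler_wpM2l// (le_trans _ (ler_norm _))//; near: n; exact: AM.
Unshelve. all: by end_near. Qed.

Lemma oP_mxact_tight m k (A : nat -> 'M[R]_(m, k))
    (Z : nat -> Omega -> 'rV[R]_k) :
  A @ \oo --> (0 : 'M[R]_(m, k)) -> tight Z ->
  oP (fun n w => mxact (A n) (Z n w)).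
Proof.
move=> /cvgr0Pnorm_le A0 tZ e del e0 del0.
have [M HM] := tZ _ del0.
have c0 : 0 < k%:R * (`|M| + 1) + 1 by rewrite ltr_wpDl// mulr_ge0// addr_ge0.
have e'0 : 0 < e / (k%:R * (`|M| + 1) + 1) by rewrite divr_gt0.
apply: whp_sub HM _; near=> n => w /= h.
have An : `|A n| <= e / (k%:R * (`|M| + 1) + 1) by near: n; exact: A0.
rewrite (le_trans (mxact_norm _ _))//.
rewrite ler_pdivlMr// mulrC in An; apply: le_trans An.
have h' : `|Z n w| <= `|M| + 1.
  by rewrite (le_trans h)// (le_trans (ler_norm _))// lerDl.
rewrite mulrAC ler_wpM2r// (@le_trans _ _ (k%:R * (`|M| + 1))) ?lerDl//.
by rewrite ler_wpM2l.
Unshelve. all: by end_near. Qed.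

(** Translates the hypotheses and the conclusion of the theorem into [oP], by equivalence of the two
    norms. The scale [s] is sqrt n for (a) and (b), and 1 for (c). *)
Lemma cvg0_oP m (s : nat -> R) (Z : nat -> Omega -> 'rV[R]_m) :
  (forall n, 0 <= s n) -> (forall n, coord_measurable (Z n)) ->
  cvg0_in_probability Pr (fun n w => s n * enorm (Z n w)) <->
  oP (fun n w => s n *: Z n w).
Proof.
move=> s0 mZ; rewrite cvg0_whp; last first.
  by move=> n; apply: measurable_funM => //; exact: measurable_enorm.
have E n w : `|s n * enorm (Z n w)| = enorm (s n *: Z n w).
  by rewrite enormZ// ger0_norm// mulr_ge0// enorm_ge0.
split=> H e del e0 del0.
  apply: whp_sub (H _ _ e0 del0) _; near=> n => w /=; rewrite E.
  exact/le_trans/norm_le_enorm.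
have c0 : 0 < m%:R + 1 :> R by rewrite ltr_wpDl.
have e'0 : 0 < e / (m%:R + 1) by rewrite divr_gt0.
apply: whp_sub (H _ _ e'0 del0) _; near=> n => w /=; rewrite E => h.
rewrite (le_trans (enorm_le_norm _))//.
rewrite ler_pdivlMr// mulrC in h; apply: le_trans h.
by rewrite ler_wpM2r// lerDl.
Unshelve. all: by end_near. Qed.

End HighProbability.

(** * Local sequences and substitution *)

Section LocalSequences.
Context (R : realType).

Lemma sqrtn_ge0 (n : nat) : 0 <= sqrtn n :> R.
Proof. exact: sqrtr_ge0. Qed.

Lemma sqrtn_gt (M : R) : \forall n \near \oo, M < sqrtn n.
Proof.
near=> n; have [M0|M0] := ltP M 0; first exact: lt_le_trans M0 (sqrtn_ge0 n).
rewrite -(ger0_norm M0) -sqrtr_sqr ltr_sqrt; last first.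
  by rewrite ltr0n; near: n; exists 1%N.
by near: n; exact: nbhs_infty_gtr.
Unshelve. all: by end_near. Qed.

Lemma sqrtn_invn (n : nat) : sqrtn n * n%:R^-1 = (sqrtn n)^-1 :> R.
Proof.
(* At n = 0 both sides vanish, the inverse of 0 being 0. *)
case: n => [|n]; first by rewrite /sqrtn sqrtr0 mul0r invr0.
have s0 : sqrtn n.+1 != 0 :> R by rewrite /sqrtn sqrtr_eq0 -ltNge.
by apply: (mulfI s0); rewrite mulrA -expr2 sqr_sqrtr ?ler0n// !divff.
Qed.

(** The ball of radius M / sqrt n eventually lies in the neighborhood. The threshold on n is uniform
    in y, so random points may be inserted. *)
Lemma near_sqrtn_scale (k : nat) (A : set 'rV[R]_k) (x : 'rV[R]_k) (M : R) :
  nbhs x A ->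
  \forall n \near \oo, forall y, `|sqrtn n *: (y - x)| <= M -> A y.
Proof.
move=> /nbhs_normP[r /= r0 rA].
near=> n => y h; apply: rA; rewrite /= distrC.
have s0 : 0 < sqrtn n :> R by near: n; exact: sqrtn_gt.
rewrite normrZ gtr0_norm// -ler_pdivlMl// in h; apply: (le_lt_trans h).
rewrite mulrC ltr_pdivrMr// mulrC -ltr_pdivrMr//.
by near: n; exact: sqrtn_gt.
Unshelve. all: by end_near. Qed.

Lemma local_sequence_cvg (k : nat) (Theta : set 'rV[R]_k) theta0 theta :
  local_sequence Theta theta0 theta -> theta @ \oo --> theta0.
Proof.
move=> [_ [M HM]] A /(near_sqrtn_scale M); apply: filterS => n; apply.
exact: le_trans (norm_le_enorm _) (HM n).
Qed.

Lemma derivmxE (k m : nat) (f : 'rV[R]_k -> 'rV[R]_m) x v :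
  mxact (derivmx f x) v = 'd f x v.
Proof. by rewrite /mxact /derivmx trmx_mul !trmxK mul_rV_lin1. Qed.

(** The Taylor remainder is at most e / (|M| + 1) times |theta_n - theta0| near theta0, and sqrt n
    times that distance is at most M. *)
Lemma local_sequence_diff (k m : nat) (Theta : set 'rV[R]_k) theta0 theta
    (f : 'rV[R]_k -> 'rV[R]_m) :
  differentiable f theta0 -> local_sequence Theta theta0 theta ->
  (fun n => sqrtn n *: (f (theta n) - f theta0)
     - mxact (derivmx f theta0) (sqrtn n *: (theta n - theta0))) @ \oo
    --> (0 : 'rV[R]_m).
Proof.
move=> df [_ [M HM]]; apply/cvgr0Pnorm_le => e e0.
have c0 : 0 < `|M| + 1 by rewrite ltr_wpDl.
have e'0 : 0 < e / (`|M| + 1) by rewrite divr_gt0.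
have /eqaddoP/(_ _ e'0) H0 := diff_locally df.
have H : \forall y \near theta0,
    `|f y - f theta0 - 'd f theta0 (y - theta0)|
    <= e / (`|M| + 1) * `|y - theta0|.
  rewrite (near_shift 0) subr0; apply: filterS H0 => h /=.
  by rewrite !fctE /= addrK opprD addrA.
have := near_sqrtn_scale M H; apply: filterS => n Hn.
have hM : `|sqrtn n *: (theta n - theta0)| <= M.
  exact: le_trans (norm_le_enorm _) (HM n).
have {Hn} := Hn _ hM.
rewrite mxactZ derivmxE -scalerBr normrZ ger0_norm ?sqrtn_ge0// => Hn.
rewrite normrZ ger0_norm ?sqrtn_ge0// in hM.
apply: (le_trans (ler_wpM2l (sqrtn_ge0 n) Hn)).
rewrite mulrCA -mulrA ler_piMr ?(ltW e0)//.
by rewrite ler_pdivrMl// mulr1 (le_trans hM)// (le_trans (ler_norm _))// lerDl.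
Qed.

End LocalSequences.

Section Substitution.
Context (R : realType) (dO : measure_display) (Omega : measurableType dO)
  (Pr : probability Omega R) (k m : nat).
Context (Theta : set 'rV[R]_k) (theta0 : 'rV[R]_k)
  (K : nat -> Omega -> 'rV[R]_k -> 'rV[R]_m) (T : nat -> Omega -> 'rV[R]_k)
  (K0 : 'rV[R]_m) (G : nat -> Omega -> 'rV[R]_m) (A : 'M[R]_(m, k)).

Let rem n w theta := sqrtn n *: (K n w theta - K0) - G n w
  - mxact A (sqrtn n *: (theta - theta0)).

(* The expansion holds simultaneously at the finitely many points
   [theta0 + g / sqrt n] with [g] in a finite net, and the equicontinuity
   hypothesis carries it over to the random point [T n w]. *)
Lemma substitution_expansion :
  open Theta -> Theta theta0 ->
  tight Pr (fun n w => sqrtn n *: (T n w - theta0)) ->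
  (forall theta, local_sequence Theta theta0 theta ->
    oP Pr (fun n w => rem n w (theta n))) ->
  (forall delta eps M : R, 0 < delta -> 0 < eps -> 0 < M ->
    exists (zeta : R) (n0 : nat), 0 < zeta /\
      forall n, (n0 <= n)%N ->
        (outer_probability Pr
          [set w | eps%:E <= ereal_sup
            [set (sqrtn n * enorm (K n w p.1 - K n w p.2))%R%:E
             | p in [set p : 'rV[R]_k * 'rV[R]_k |
                 [/\ Theta p.1, Theta p.2,
                     (sqrtn n * enorm (p.1 - theta0) <= M)%R
                   & (sqrtn n * enorm (p.1 - p.2) <= zeta)%R]]]]
         <= delta%:E)%E) ->
  forall e del, 0 < e -> 0 < del ->
    whp Pr del (fun n => [set w | Theta (T n w) /\ `|rem n w (T n w)| <= e]).
Proof.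
move=> oTheta Theta0 tT lin hsup e del e0 del0.
have Tnbhs : nbhs theta0 Theta by exact: open_nbhs_nbhs.
(* The error splits into three terms of size e / 3. Of [del], a quarter goes to tightness, a quarter
   to equicontinuity and half to the net; equicontinuity is invoked at an eighth, for the strict
   slack that outer probability requires. *)
have e3 : 0 < e / 3 by rewrite divr_gt0.
have d2 : 0 < del / 2 by rewrite divr_gt0.
have d4 : 0 < del / 2 / 2 by rewrite divr_gt0.
have d8 : 0 < del / 2 / 2 / 2 by rewrite divr_gt0.
have [M tM] := tT _ d4.
(* Tightness is in the sup norm and equicontinuity in the Euclidean one, whence the factor k; the
   added 1 ensures positivity. *)
pose M' := k%:R * `|M| + 1.
have M'0 : 0 < M' by rewrite ltr_wpDl// mulr_ge0.
have [zeta [n0 [zeta0 Hsup]]] := hsup _ _ _ d8 e3 M'0.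
(* Outside the exceptional set the bound holds for all admissible pairs at once, so a pair depending
   on [w] is allowed. *)
have {}Hsup : whp Pr (del / 2 / 2) (fun n => [set w | forall p1 p2,
    Theta p1 -> Theta p2 -> sqrtn n * enorm (p1 - theta0) <= M' ->
    sqrtn n * enorm (p1 - p2) <= zeta ->
    sqrtn n * enorm (K n w p1 - K n w p2) < e / 3]).
  have dd : del / 2 / 2 / 2 < del / 2 / 2.
    by rewrite ltr_pdivrMr// ltr_pMr// ltr1n.
  have /outer_probability_whp/(_ _ dd)/whp_sub :=
    @filterS _ _ eventually_filter _ _ Hsup (nbhs_infty_ge n0).
  apply; near=> n => w /= nsup p1 p2 T1 T2 h1 h2.
  rewrite ltNge; apply/negP => H; apply: nsup.
  apply: (@le_trans _ _ (sqrtn n * enorm (K n w p1 - K n w p2))%:E).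
    by rewrite lee_fin; exact: H.
  by apply: ereal_sup_ubound; exists (p1, p2).
pose cA := k%:R * `|A| + 1.
have cA0 : 0 < cA by rewrite ltr_wpDl// mulr_ge0.
have ck0 : 0 < k%:R + 1 :> R by rewrite ltr_wpDl.
(* The first entry puts net neighbors within the Euclidean distance zeta, the second keeps the
   linear term below e / 3. *)
pose z := Num.min (zeta / (k%:R + 1)) (e / 3 / cA).
have z0 : 0 < z by rewrite lt_min !divr_gt0.
have kz : k%:R * z <= zeta.
  have : z <= zeta / (k%:R + 1) by rewrite ge_min lexx.
  rewrite ler_pdivlMr// mulrC; apply: le_trans.
  by rewrite ler_wpM2r ?(ltW z0)// lerDl.
have Az : k%:R * `|A| * z <= e / 3.
  have : z <= e / 3 / cA by rewrite ge_min lexx orbT.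
  rewrite ler_pdivlMr// mulrC; apply: le_trans.
  by rewrite ler_wpM2r ?(ltW z0)// lerDl.
have [L HL] := finite_net k M z0.
pose pt n (g : 'rV[R]_k) := theta0 + (sqrtn n)^-1 *: g.
have ptE n g : 0 < sqrtn n :> R -> sqrtn n *: (pt n g - theta0) = g.
  by move=> s0; rewrite /pt addrC addKr scalerA mulfV ?gt_eqF// scale1r.
have ptTheta g : \forall n \near \oo, Theta (pt n g).
  near=> n; apply: (near (near_sqrtn_scale `|g| Tnbhs) n) => //.
  by rewrite ptE//; near: n; exact: sqrtn_gt.
have grid : whp Pr (del / 2) (fun n => [set w | forall g, g \in L ->
    Theta (pt n g) /\ `|rem n w (pt n g)| <= e / 3]).
  apply: whp_seq => // g _ del' del'0.
  (* For small n the net point may leave Theta; replacing it there by [theta0] gives a genuine local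
     sequence, equal to the net point for all large n. *)
  pose th n := if `[< Theta (pt n g) >] then pt n g else theta0.
  have : oP Pr (fun n w => rem n w (th n)).
    apply: lin; split; first by move=> n; rewrite /th; case: asboolP.
    exists (enorm g) => n; rewrite /th; case: asboolP => _; last first.
      by rewrite subrr scaler0 enorm0 enorm_ge0.
    case: n => [|n]; last by rewrite ptE// sqrtr_gt0.
    by rewrite /sqrtn sqrtr0 scale0r enorm0 enorm_ge0.
  move=> /(_ _ _ e3 del'0)/whp_sub; apply; near=> n => w /=.
  have Tp : Theta (pt n g) by near: n; exact: ptTheta.
  by rewrite /th (asboolT Tp).
have := whpI (whpI tM Hsup) grid; rewrite -!splitr => /whp_sub; apply.
near=> n => w [[/= hM hsupn] hgrid].
have s0 : 0 < sqrtn n :> R by near: n; exact: sqrtn_gt.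
have TT : Theta (T n w) by apply: (near (near_sqrtn_scale M Tnbhs) n).
split => //; set h := sqrtn n *: (T n w - theta0) in hM.
have [g gL hg] := HL _ hM.
have [Tg remg] := hgrid _ gL.
have Esub : sqrtn n *: (T n w - pt n g) = h - g.
  by rewrite -[in RHS](ptE n g s0) /h -scalerBr opprB addrA subrK.
have : sqrtn n * enorm (K n w (T n w) - K n w (pt n g)) < e / 3.
  apply: hsupn => //; rewrite -enormZ ?(ltW s0)// ?Esub;
    rewrite (le_trans (enorm_le_norm _))//.
    rewrite /M' (@le_trans _ _ (k%:R * `|M|)) ?lerDl// ler_wpM2l//.
    exact: le_trans hM (ler_norm _).
  by rewrite (le_trans _ kz)// ler_wpM2l.
rewrite -enormZ ?(ltW s0)// => /ltW/(le_trans (norm_le_enorm _)) hK.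
(* The three terms are controlled by equicontinuity, by the expansion at the net point and by the
   mesh of the net. *)
have -> : rem n w (T n w) = sqrtn n *: (K n w (T n w) - K n w (pt n g))
    + rem n w (pt n g) - mxact A (h - g).
  rewrite /rem ptE// mxactB -/h !scalerBr.
  set a := _ *: K n w (T n w); set b := _ *: K n w (pt n g); set c := _ *: K0.
  by apply/matrixP => i j; rewrite !mxE; ring.
have hA : `|mxact A (h - g)| <= e / 3.
  by rewrite (le_trans (mxact_norm _ _))// (le_trans _ Az)//
    ler_wpM2l ?mulr_ge0.
rewrite (le_trans (ler_normB _ _))//.
rewrite (le_trans (lerD (ler_normD _ _) (lexx _)))//.
lra.
Unshelve. all: by end_near. Qed.

End Substitution.

(** * Tightness of normalized sums *)

Section ScoreTightness.
Context (R : realType) (dO : measure_display) (Omega : measurableType dO)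
  (Pr : probability Omega R).

Lemma eq_tight m (Z1 Z2 : nat -> Omega -> 'rV[R]_m) :
  (forall n w, Z1 n w = Z2 n w) -> tight Pr Z1 -> tight Pr Z2.
Proof.
move=> E t del /t[M HM]; exists M; apply: whp_sub HM _.
by near=> n => w /=; rewrite E.
Unshelve. all: by end_near. Qed.

Lemma tight_sum m p (F : 'I_p -> nat -> Omega -> 'rV[R]_m) :
  (forall i, tight Pr (F i)) -> tight Pr (fun n w => \sum_(i < p) F i n w).
Proof.
elim: p F => [|p IH] F tF.
  apply: (eq_tight (Z1 := fun _ _ => 0)) => [n w|]; first by rewrite big_ord0.
  by apply: (tight_bounded _ (M := 0)); near=> n; rewrite normr0.
apply: (eq_tight (Z1 := fun n w =>
  \sum_(i < p) F (widen_ord (leqnSn p) i) n w + F ord_max n w)) => [n w|].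
  by rewrite big_ord_recr.
by apply: tightD => //; apply: IH => i; exact: tF.
Unshelve. all: by end_near. Qed.

(** Expanding in the standard basis writes [Z] as a finite sum of scalar tight sequences times fixed
    vectors. *)
Lemma tight_coord m (Z : nat -> Omega -> 'rV[R]_m) :
  (forall i del, 0 < del ->
    exists M, whp Pr del (fun n => [set w | `|Z n w 0 i| <= M])) ->
  tight Pr Z.
Proof.
move=> H; apply: (eq_tight (Z1 := fun n w =>
  \sum_(i < m) (Z n w 0 i) *: (delta_mx 0 i : 'rV[R]_m))) => [n w|].
  by rewrite -row_sum_delta.
apply: tight_sum => i del /(H i)[M HM].
exists (M * `|delta_mx 0 i : 'rV[R]_m|); apply: whp_sub HM _.
by near=> n => w /= h; rewrite normrZ ler_wpM2r.
Unshelve. all: by end_near. Qed.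

Lemma sum_sample_tight (d : measure_display) (X : measurableType d)
    (Xs : nat -> {RV Pr >-> X}) (k m : nat) (Theta : set 'rV[R]_k)
    (P : 'rV[R]_k -> probability X R) (theta0 : 'rV[R]_k)
    (psi : X -> 'rV[R]_k -> 'rV[R]_m) :
  open Theta -> Theta theta0 -> iid Xs (P theta0) -> Psi Theta P psi ->
  tight Pr (fun n w => (sqrtn n)^-1 *: sum_sample Xs psi n theta0 w).
Proof.
move=> oT T0 Hiid [mpsi /(_ _ T0)[psi0 psi2]]; apply: tight_coord => i del del0.
have mf := measurable_section i oT mpsi T0.
have I2 : (P theta0).-integrable setT (fun x => (enorm (psi x theta0) ^+ 2)%:E).
  apply/integrableP; split.
    apply/measurable_EFinP; apply: measurable_funX.
    apply: measurable_enorm => j.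
    exact: measurable_section oT mpsi T0.
  by under eq_integral do rewrite gee0_abs ?lee_fin ?sqr_ge0//.
have If2 : (P theta0).-integrable setT (fun x => (psi x theta0 0 i ^+ 2)%:E).
  apply: (le_integrable _ _ _ I2) => //.
    by apply/measurable_EFinP; exact: measurable_funX.
  move=> x _; rewrite /= lee_fin !ger0_norm ?sqr_ge0//.
  rewrite -[leLHS]real_normK ?num_real// ler_sqr ?nnegrE ?enorm_ge0//.
  exact: le_trans (mxnorm_ge_coord _ _ _) (norm_le_enorm _).
(* A vanishing integral does not by itself give integrability; it comes from |f| <= 1 + f^2 under a
   probability measure. *)
have If : (P theta0).-integrable setT (EFin \o (fun x => psi x theta0 0 i)).
  have I1 : (P theta0).-integrable setT (cst 1%:E : X -> \bar R).
    exact: (finite_measure_integrable_cst _ _ measurableT).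
  apply: (le_integrable _ _ _ (integrableD _ I1 If2)) => //.
    exact/measurable_EFinP.
  move=> x _; rewrite /= lee_fin [leRHS]ger0_norm ?addr_ge0 ?sqr_ge0//.
  rewrite -[_ ^+ 2]real_normK ?num_real//.
  have := normr_ge0 (psi x theta0 0 i); nra.
have [M HM] := iid_sum_tight Hiid If If2 (psi0 i) del0.
exists M; near=> n; have [B [mB PB sB]] := HM n; exists B; split => //.
move=> w /sB /=; congr (`|_| <= _).
by rewrite mxE summxE.
Unshelve. all: by end_near. Qed.

End ScoreTightness.

(** * Assembling the expansions *)

(** Starting from the expansion at theta0, the successive terms recenter the sum by (c), recenter
    kappa by its derivative, replace D + C by the matrix B at theta_n, and turn B s (T - th) into a
    sum by (a). Here s is sqrt n and s' its inverse, though the identity holds for any scalars. *)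
Lemma substitution_remainder (R : realType) (m k : nat) (s s' : R)
    (D C B : 'M[R]_(m, k)) (k1 kth k0 Sth S0 : 'rV[R]_m)
    (T th th0 S : 'rV[R]_k) :
  s *: (k1 - k0) - s' *: S0 - mxact (D + C) (s *: (T - th0))
  - (s' *: Sth - s' *: S0 - mxact C (s *: (th - th0)))
  - (s *: (kth - k0) - mxact D (s *: (th - th0)))
  - mxact (B - (D + C)) (s *: (T - th))
  + mxact B (s *: (T - th) - s' *: S)
  = s *: (k1 - kth) - s' *: (Sth + mxact B S).
Proof.
rewrite mxactBl !mxactDl (mxactB B) !mxactZ !mxactB.
move: (mxact D T) (mxact C T) (mxact B T) (mxact D th) (mxact C th)
  (mxact B th) (mxact D th0) (mxact C th0) (mxact B S) => *.
by apply/matrixP => i j; rewrite !mxE; ring.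
Qed.

Theorem theorem2p2 (R : realType)
  (d : measure_display) (X : measurableType d)
  (k m : nat)
  (Theta : set 'rV[R]_k) (Theta_open : open Theta)
  (P : 'rV[R]_k -> probability X R)
  (theta0 : 'rV[R]_k) (theta0_Theta : Theta theta0)
  (dO : measure_display) (Omega : measurableType dO)
  (Pr : probability Omega R) (Xs : nat -> {RV Pr >-> X})
  (Xs_iid : iid Xs (P theta0))
  (kappa : 'rV[R]_k -> 'rV[R]_m) (kappa_C1 : C1_near kappa theta0)
  (psi_theta : X -> 'rV[R]_k -> 'rV[R]_k)
  (psi_thetaP : Psi Theta P psi_theta)
  (psi_kappa : X -> 'rV[R]_k -> 'rV[R]_m)
  (psi_kappaP : Psi Theta P psi_kappa)
  (t : forall n, n.-tuple X -> 'rV[R]_k)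
  (t_meas : forall n, measurable_fun setT (t n : n.-tuple X -> borel_rV R k))
  (kn : forall n, n.-tuple X -> 'rV[R]_k -> 'rV[R]_m)
  (kn_meas : forall n, measurable_on Theta (kn n))
  (c : 'rV[R]_k -> 'M[R]_(m, k)) (c_cont : {for theta0, continuous c})
  (ha : forall theta, local_sequence Theta theta0 theta ->
    cvg0_in_probability Pr (fun n w =>
      sqrtn n * enorm (t n (sample Xs n w) - theta n
                       - n%:R^-1 *: sum_sample Xs psi_theta n (theta n) w)))
  (hb : forall theta, local_sequence Theta theta0 theta ->
    cvg0_in_probability Pr (fun n w =>
      sqrtn n * enorm (kn n (sample Xs n w) (theta n) - kappa (theta n)
                       - n%:R^-1 *: sum_sample Xs psi_kappa n (theta n) w)))
  (hc : forall theta, local_sequence Theta theta0 theta ->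
    cvg0_in_probability Pr (fun n w =>
      enorm ((sqrtn n)^-1 *: sum_sample Xs psi_kappa n (theta n) w
             - (sqrtn n)^-1 *: sum_sample Xs psi_kappa n theta0 w
             - mxact (c theta0) (sqrtn n *: (theta n - theta0)))))
  (hsup : forall delta eps M : R, 0 < delta -> 0 < eps -> 0 < M ->
    exists (zeta : R) (n0 : nat), 0 < zeta /\
      forall n, (n0 <= n)%N ->
        (outer_probability Pr
          [set w | eps%:E <= ereal_sup
            [set (sqrtn n * enorm (kn n (sample Xs n w) p.1
                                   - kn n (sample Xs n w) p.2))%R%:E
             | p in [set p : 'rV[R]_k * 'rV[R]_k |
                 [/\ Theta p.1, Theta p.2,
                     (sqrtn n * enorm (p.1 - theta0) <= M)%R
                   & (sqrtn n * enorm (p.1 - p.2) <= zeta)%R]]]]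
         <= delta%:E)%E)
  (* the substitution estimator, arbitrary where t_n falls outside Theta *)
  (kappa1 : forall n, n.-tuple X -> 'rV[R]_m)
  (kappa1_meas : forall n,
    measurable_fun setT (kappa1 n : n.-tuple X -> borel_rV R m))
  (kappa1E : forall n (x : n.-tuple X),
    Theta (t n x) -> kappa1 n x = kn n x (t n x)) :
  loc_asymp_linear Xs Theta theta0 kappa1 kappa
    (fun x theta => psi_kappa x theta
       + mxact (derivmx kappa theta + c theta) (psi_theta x theta)).
Proof.
(* The constant sequence makes (a) available at theta0 itself, as the tightness of the estimator
   requires. *)
have kc0 : local_sequence Theta theta0 (fun=> theta0).
  split => //; exists 0 => n.
  by rewrite subrr scaler0 enorm0.
have mt n : coord_measurable (fun w => t n (sample Xs n w)).
  move=> i.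
  apply: (measurableT_comp (measurableT_comp (measurable_coord i) (t_meas n))).
  exact: measurable_sample.
have m1 n : coord_measurable (fun w => kappa1 n (sample Xs n w)).
  move=> i; have mi := measurableT_comp (measurable_coord i) (kappa1_meas n).
  apply: (measurableT_comp mi); exact: measurable_sample.
have mk n th : Theta th -> coord_measurable (fun w => kn n (sample Xs n w) th).
  move=> Tth i.
  have mi := measurable_section i Theta_open (kn_meas n) Tth.
  apply: (measurableT_comp mi); exact: measurable_sample.
have mSt n th : Theta th -> coord_measurable (sum_sample Xs psi_theta n th).
  move=> Tth; apply: coord_measurable_sum_sample => i.
  exact: measurable_section Theta_open psi_thetaP.1 Tth.
have mSk n th : Theta th -> coord_measurable (sum_sample Xs psi_kappa n th).
  move=> Tth; apply: coord_measurable_sum_sample => i.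
  exact: measurable_section Theta_open psi_kappaP.1 Tth.
have oa theta : local_sequence Theta theta0 theta -> oP Pr (fun n w =>
    sqrtn n *: (t n (sample Xs n w) - theta n)
    - (sqrtn n)^-1 *: sum_sample Xs psi_theta n (theta n) w).
  move=> ls; have := ha _ ls; rewrite cvg0_oP; first last.
  - move=> n; apply: coord_measurableB; last exact/coord_measurableZ/mSt/ls.1.
    by apply: coord_measurableB => //; exact: coord_measurable_cst.
  - exact: sqrtn_ge0.
  by apply: eq_oP; near=> n => w; rewrite scalerBr scalerA sqrtn_invn.
have ob theta : local_sequence Theta theta0 theta -> oP Pr (fun n w =>
    sqrtn n *: (kn n (sample Xs n w) (theta n) - kappa (theta n))
    - (sqrtn n)^-1 *: sum_sample Xs psi_kappa n (theta n) w).
  move=> ls; have := hb _ ls; rewrite cvg0_oP; first last.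
  - move=> n; apply: coord_measurableB; last exact/coord_measurableZ/mSk/ls.1.
    by apply: coord_measurableB; [exact/mk/ls.1|exact: coord_measurable_cst].
  - exact: sqrtn_ge0.
  by apply: eq_oP; near=> n => w; rewrite scalerBr scalerA sqrtn_invn.
have oc theta : local_sequence Theta theta0 theta -> oP Pr (fun n w =>
    (sqrtn n)^-1 *: sum_sample Xs psi_kappa n (theta n) w
    - (sqrtn n)^-1 *: sum_sample Xs psi_kappa n theta0 w
    - mxact (c theta0) (sqrtn n *: (theta n - theta0))).
  move=> ls; have := hc _ ls.
  under eq_fun do under eq_fun do rewrite -[enorm _]mul1r.
  rewrite (cvg0_oP Pr (s := fun=> 1)); first last.
  - move=> n; apply: coord_measurableB; last exact: coord_measurable_cst.
    apply: coord_measurableB; apply: coord_measurableZ; last exact: mSk.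
    exact/mSk/ls.1.
  - by [].
  by apply: eq_oP; near=> n => w; rewrite scale1r.
have [dk ck] := nbhs_singleton kappa_C1.
have od theta : local_sequence Theta theta0 theta -> oP Pr (fun n _ =>
    sqrtn n *: (kappa (theta n) - kappa theta0)
    - mxact (derivmx kappa theta0) (sqrtn n *: (theta n - theta0))).
  by move=> ls; apply: oP_cvg0; exact: local_sequence_diff dk ls.
have tT : tight Pr (fun n w => sqrtn n *: (t n (sample Xs n w) - theta0)).
  apply: eq_tight (tightD (oP_tight (oa _ kc0))
    (sum_sample_tight Theta_open theta0_Theta Xs_iid psi_thetaP)) => n w.
  by rewrite subrK.
pose B0 := derivmx kappa theta0 + c theta0.
have oS : oP Pr (fun n w => sqrtn n *: (kappa1 n (sample Xs n w) - kappa theta0)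
    - (sqrtn n)^-1 *: sum_sample Xs psi_kappa n theta0 w
    - mxact B0 (sqrtn n *: (t n (sample Xs n w) - theta0))).
  have lin theta : local_sequence Theta theta0 theta -> oP Pr (fun n w =>
      sqrtn n *: (kn n (sample Xs n w) (theta n) - kappa theta0)
      - (sqrtn n)^-1 *: sum_sample Xs psi_kappa n theta0 w
      - mxact B0 (sqrtn n *: (theta n - theta0))).
    (* Adding (b), (c) and the Taylor expansion cancels kappa(theta_n) and the sums at theta_n. *)
    move=> ls; apply: eq_oP (oPD (oPD (ob _ ls) (oc _ ls)) (od _ ls)).
    near=> n => w; rewrite /B0 mxactDl !scalerBr.
    by apply/matrixP => i j; rewrite !mxE; ring.
  have := @substitution_expansion _ _ _ Pr _ _ _ _
    (fun n w => kn n (sample Xs n w)) (fun n w => t n (sample Xs n w)) _ _ _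
    Theta_open theta0_Theta tT lin hsup.
  (* The expansion comes with the event that the estimator lies in Theta, where [kappa1] is the
     substituted statistic; its arbitrary values elsewhere fall into the exceptional set. *)
  move=> H e del e0 del0; apply: whp_sub (H e del e0 del0) _.
  by near=> n => w /= [Tt]; rewrite kappa1E.
move=> theta ls; rewrite cvg0_oP; first last.
- move=> n; apply: coord_measurableB.
    by apply: coord_measurableB => //; exact: coord_measurable_cst.
  apply: coord_measurableZ; apply: coord_measurable_sum_sample.
  apply: coord_measurableD.
    by move=> i; exact: measurable_section Theta_open psi_kappaP.1 (ls.1 n).
  apply: coord_measurable_mxact => i.
  exact: measurable_section Theta_open psi_thetaP.1 (ls.1 n).
- exact: sqrtn_ge0.
pose B n := derivmx kappa (theta n) + c (theta n).
(* Local sequences converge to theta0, where both kappa' and c are continuous. *)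
have Bcvg : B @ \oo --> B0.
  have tc := local_sequence_cvg ls.
  by apply: cvgD; [exact: (cvg_comp _ _ tc ck)|exact: (cvg_comp _ _ tc c_cont)].
have B0cvg : (fun n => B n - B0) @ \oo --> (0 : 'M[R]_(m, k)).
  by rewrite -(subrr B0); apply: cvgB => //; exact: cvg_cst.
have Bbnd : \forall n \near \oo, `|B n| <= `|B0| + 1.
  move/cvgr0Pnorm_le: B0cvg => /(_ _ ltr01); apply: filterS => n Hn.
  by rewrite -(subrK B0 (B n)) addrC (le_trans (ler_normD _ _))// lerD2l.
(* Recentering from theta0 to theta_n shifts by a bounded deterministic sequence. *)
have tU : tight Pr (fun n w => sqrtn n *: (t n (sample Xs n w) - theta n)).
  have [M HM] := ls.2.
  have tb : tight Pr (fun n (_ : Omega) => - (sqrtn n *: (theta n - theta0))).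
    apply: (@tight_bounded _ _ _ Pr _ _ M); near=> n.
    by rewrite normrN (le_trans (norm_le_enorm _)).
  apply: eq_tight (tightD tT tb) => n w.
  by rewrite -scalerBr opprB addrA subrK.
have o1 := oP_mxact Bbnd (oa _ ls).
have o2 := oP_mxact_tight B0cvg tU.
apply: eq_oP (oPD (oPB (oPB (oPB oS (oc _ ls)) (od _ ls)) o2) o1).
near=> n => w.
have -> : sum_sample Xs (fun x th => psi_kappa x th
       + mxact (derivmx kappa th + c th) (psi_theta x th)) n (theta n) w
    = sum_sample Xs psi_kappa n (theta n) w
      + mxact (B n) (sum_sample Xs psi_theta n (theta n) w).
  by rewrite /sum_sample big_split /= mxact_sum.
by rewrite [in RHS]scalerBr scalerA sqrtn_invn; exact: substitution_remainder.
Unshelve. all: by end_near. Qed.
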